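(* Let $A$ be a weighted $\mathbb{N}$-filtered solvable polynomial algebra with the $\mathbb{N}$-filtration $FA=\{F_pA\}_{p\in\mathbb{N}}$ constructed with respect to a given positive-degree function $d(~)$ on $A$. Let $M$ be a filtered $A$-module with the filtration $FM=\{F_qM\}_{q\in\mathbb{N}}$, and $N$ a submodule of $M$ with the induced filtration $FN=\{F_qN=N\cap F_qM\}_{q\in\mathbb{N}}$. A finite subset of nonzero elements $W=\{\xi_1,\ldots,\xi_s\}\subset N$ is a minimal standard basis of $N$ with respect to $FN$ if and only if $\sigma(W)=\{\sigma(\xi_1),\ldots,\sigma(\xi_s)\}$ is a minimal homogeneous generating set of $G(N)$ if and only if $\tau(W)=\{\widetilde{\xi}_1,\ldots,\widetilde{\xi}_s\}$ is a minimal homogeneous generating set of $\widetilde{N}$. Hence, any two minimal standard bases of $N$ have the same number of elements and the same number of elements of the same filtered degree.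
   Context: $K$ is a field, $\mathbb{N}$ the nonnegative integers, modules are left unitary modules. Solvable polynomial algebra: a $K$-algebra $A=K[a_1,\ldots,a_n]$ with minimal generating set $\{a_1,\ldots,a_n\}$ having $K$-basis $\mathscr{B}=\{a^\alpha=a_1^{\alpha_1}\cdots a_n^{\alpha_n}\mid\alpha=(\alpha_1,\ldots,\alpha_n)\in\mathbb{N}^n\}$ and a total ordering $\prec$ on $\mathscr{B}$ such that, writing $\mathbf{LM}(f)$ for the $\prec$-largest monomial occurring in $f\neq0$: (1) $\prec$ is a well-ordering; (2) $a^\alpha\prec a^\beta$ and $\mathbf{LM}(a^\gamma a^\alpha a^\eta),\mathbf{LM}(a^\gamma a^\beta a^\eta)\notin K$ imply $\mathbf{LM}(a^\gamma a^\alpha a^\eta)\prec\mathbf{LM}(a^\gamma a^\beta a^\eta)$; (3) if $a^\beta\ne a^\gamma$ and $a^\gamma=\mathbf{LM}(a^\alpha a^\beta a^\eta)$ then $a^\beta\prec a^\gamma$; and for all $\alpha,\beta$, $a^\alpha a^\beta=\lambda_{\alpha,\beta}a^{\alpha+\beta}+f_{\alpha,\beta}$ with $\lambda_{\alpha,\beta}\in K\setminus\{0\}$ and $f_{\alpha,\beta}=0$ or $\mathbf{LM}(f_{\alpha,\beta})\prec a^{\alpha+\beta}$. A positive-degree function $d(~)$ is given by positive integers $d(a_i)=m_i$, with $d(a^\alpha)=\sum_i m_i\alpha_i$. $A$ is a weighted $\mathbb{N}$-filtered solvable polynomial algebra with respect to $d(~)$ if the subspaces $F_pA=K\text{-span}\{a^\alpha\in\mathscr{B}\mid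 d(a^\alpha)\le p\}$ satisfy $F_pAF_qA\subseteq F_{p+q}A$ for all $p,q\in\mathbb{N}$. A filtered $A$-module $M$ is an $A$-module with $K$-subspaces $F_qM$ ($q\in\mathbb{N}$) such that $F_qM\subseteq F_{q+1}M$, $\cup_qF_qM=M$, and $F_pAF_qM\subseteq F_{p+q}M$ for all $p,q\in\mathbb{N}$; put $F_{-1}M=0$, $F_{-1}N=0$, $F_{-1}A=0$. For $0\ne\xi\in M$, the filtered degree $d_{\rm fil}(\xi)=q$ means $\xi\in F_qM\setminus F_{q-1}M$. The associated graded algebra and module are $G(A)=\oplus_pF_pA/F_{p-1}A$ and $G(N)=\oplus_qF_qN/F_{q-1}N$ (a graded $G(A)$-module). The Rees algebra and module are $\widetilde{A}=\oplus_pF_pA$ and $\widetilde{N}=\oplus_qF_qN$ (external direct sums graded by $p$ and $q$; $\widetilde{N}$ is a graded $\widetilde{A}$-module). For $\xi\in N$ with $d_{\rm fil}(\xi)=q$, $\sigma(\xi)=\xi+F_{q-1}N\in G(N)_q$, and $\widetilde{\xi}$ is the element $\xi$ viewed in $\widetilde{N}_q=F_qN$. Standard basis: a finite subset $W=\{\xi_1,\ldots,\xi_s\}$ of nonzero elements of $N$ is a standard basis of $N$ (with respect to the induced filtration $FN$) if it satisfies one of the following equivalent conditions: (i) there is a subset $\{n_1,\ldots,n_s\}\subset\mathbb{N}$ with $F_qN=\sum_{i=1}^s\left(\sum_{p_i+n_i\le q}F_{p_i}A\right)\xi_i$ for all $q\in\mathbb{N}$; (ii) $G(N)=\sum_{i=1}^sG(A)\sigma(\xi_i)$;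 (iii) $\widetilde{N}=\sum_{i=1}^s\widetilde{A}\,\widetilde{\xi}_i$. A standard basis is minimal if no proper subset of it is a standard basis of $N$ with respect to $FN$. A minimal homogeneous generating set of a graded module is a generating set consisting of homogeneous elements no proper subset of which generates the module.
   Formalization: The condition on σ(W) also requires σ(ξ_1),…,σ(ξ_s) to be pairwise distinct; read as a bare set the equivalence fails, e.g. W={e1, e1+e2, e2} in A⊕A with e1 of degree 1 and e2 of degree 0. *)

(* Defs.v *)
From HB Require Import structures.
From mathcomp Require Import all_boot all_order all_algebra.
From mathcomp Require Import finmap.
From mathcomp Require Import boolp classical_sets wochoice.

Set Implicit Arguments.
Unset Strict Implicit.
Unset Printing Implicit Defensive.

Import GRing.Theory.
Local Open Scope fset_scope.
Local Open Scope quotient_scope.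
Local Open Scope ring_scope.

Record dsum (V : nat -> zmodType) := DSum {
  coord :> forall q, V q;
  coordP : exists m, forall q, (m <= q)%N -> coord q = 0
}.

HB.instance Definition _ V := gen_eqMixin (dsum V).
HB.instance Definition _ V := gen_choiceMixin (dsum V).

Section DirectSum.
Variable V : nat -> zmodType.
Implicit Types f g : dsum V.

Lemma dsumP f g : (forall q, f q = g q) -> f = g.
Proof.
case: f g => [f Pf] [g Pg] /= fg.
have efg : f = g by apply: functional_extensionality_dep.
by case: _ / efg Pg {fg} => Pg; congr DSum; apply: Prop_irrelevance.
Qed.

Definition dsum0 : dsum V.
Proof. by exists (fun=> 0); exists 0. Defined.

Definition dsum_opp f : dsum V.
Proof.
exists (fun q => - f q); case: (coordP f) => m fm.
by exists m => q /fm->; rewrite oppr0.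
Defined.

Definition dsum_add f g : dsum V.
Proof.
exists (fun q => f q + g q); case: (coordP f) (coordP g) => [m fm] [k gk].
exists (maxn m k) => q; rewrite geq_max => /andP[/fm-> /gk->].
exact: addr0.
Defined.

Lemma dsum_addA : associative dsum_add.
Proof. by move=> f g h; apply: dsumP => q /=; rewrite addrA. Qed.
Lemma dsum_addC : commutative dsum_add.
Proof. by move=> f g; apply: dsumP => q /=; rewrite addrC. Qed.
Lemma dsum_add0 : left_id dsum0 dsum_add.
Proof. by move=> f; apply: dsumP => q /=; rewrite add0r. Qed.
Lemma dsum_addN : left_inverse dsum0 dsum_opp dsum_add.
Proof. by move=> f; apply: dsumP => q /=; rewrite addNr. Qed.

HB.instance Definition _ :=
  GRing.isZmodule.Build (dsum V) dsum_addA dsum_addC dsum_add0 dsum_addN.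

Definition dsum_in q (v : V q) : dsum V.
Proof.
exists (dfwith (fun q => 0 : V q) v); exists q.+1 => k qk.
by rewrite dfwith_out // ltn_eqF.
Defined.

Definition homogeneous f := exists q (v : V q), f = dsum_in v.

End DirectSum.

(* The product of the parts of degrees p and q lands in the part of degree n
   for any n provably equal to p + q; this avoids casts along nat equalities
   such as associativity of addition *)
Record gradedRing := GradedRing {
  rpart :> nat -> zmodType;
  rone : rpart 0;
  rmul : forall p q n, (p + q = n)%N -> rpart p -> rpart q -> rpart n;
  rmulDl : forall p q n (e : (p + q = n)%N) x y z,
    rmul e (x + y) z = rmul e x z + rmul e y z;
  rmulDr : forall p q n (e : (p + q = n)%N) x y z,
    rmul e x (y + z) = rmul e x y + rmul e x z;
  rmulA : forall p q r s t n (e1 : (p + q = s)%N) (e2 : (s + r = n)%N)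
                 (e3 : (q + r = t)%N) (e4 : (p + t = n)%N) x y z,
    rmul e4 x (rmul e3 y z) = rmul e2 (rmul e1 x y) z;
  rmul1l : forall q (e : (0 + q = q)%N) x, rmul e rone x = x;
  rmul1r : forall q (e : (q + 0 = q)%N) x, rmul e x rone = x
}.

Record gradedModule (R : gradedRing) := GradedModule {
  mpart :> nat -> zmodType;
  mact : forall p q n, (p + q = n)%N -> R p -> mpart q -> mpart n;
  mactDl : forall p q n (e : (p + q = n)%N) x y v,
    mact e (x + y) v = mact e x v + mact e y v;
  mactDr : forall p q n (e : (p + q = n)%N) x u v,
    mact e x (u + v) = mact e x u + mact e x v;
  mactA : forall p q r s t n (e1 : (p + q = s)%N) (e2 : (s + r = n)%N)
                 (e3 : (q + r = t)%N) (e4 : (p + t = n)%N) x y v,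
    mact e4 x (mact e3 y v) = mact e2 (rmul e1 x y) v;
  mact1 : forall q (e : (0 + q = q)%N) v, mact e (rone R) v = v
}.

Definition gsum (R : gradedRing) : Type := dsum (rpart R).
Definition gsumM (R : gradedRing) (W : gradedModule R) : Type := dsum (mpart W).

HB.instance Definition _ R := GRing.Zmodule.on (gsum R).
HB.instance Definition _ R (W : gradedModule R) := GRing.Zmodule.on (gsumM W).

Lemma triangular_sum3 (G : zmodType) (T : nat -> nat -> nat -> G) n :
  \sum_(i < n.+1) \sum_(j < (n - i).+1) T i j (n - i - j)%N =
  \sum_(i < n.+1) \sum_(j < i.+1) T j (i - j)%N (n - i)%N.
Proof.
pose U i k := if (i <= k)%N then T i (k - i)%N (n - k)%N else 0.
transitivity (\sum_(0 <= i < n.+1) \sum_(0 <= k < n.+1) U i k).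
  rewrite big_mkord; apply: eq_bigr => i _.
  rewrite -(big_mkord predT (fun j => T i j (n - i - j)%N)) -big_mkcond /=.
  rewrite -(@big_nat_widenl _ _ _ i 0 n.+1 predT) //.
  transitivity (\sum_(0 + i <= k < n.+1) T i (k - i)%N (n - k)%N); last by [].
  rewrite big_addn subSn ?leq_ord //.
  by apply: eq_bigr => j _; rewrite addnK addnC subnDA.
rewrite exchange_big_nat /= big_mkord; apply: eq_bigr => k _.
rewrite -(big_mkord predT (fun j => T j (k - j)%N (n - k)%N)) -big_mkcond /=.
rewrite [RHS](@big_nat_widen _ _ _ 0 k.+1 n.+1) ?ltn_ord //.
Qed.

Section Convolution.
Variables (R : gradedRing) (W : gradedModule R).

Lemma mact0l p q n (e : (p + q = n)%N) v : mact (g := W) e 0 v = 0.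
Proof. by apply: (addrI (mact e 0 v)); rewrite -mactDl !addr0. Qed.

Lemma mact0r p q n (e : (p + q = n)%N) x : mact (g := W) e x 0 = 0.
Proof. by apply: (addrI (mact e x 0)); rewrite -mactDr !addr0. Qed.

Lemma mact_suml p q n (e : (p + q = n)%N) k (F : 'I_k -> R p) v :
  mact (g := W) e (\sum_i F i) v = \sum_i mact e (F i) v.
Proof.
elim: k F => [|k IH] F; first by rewrite !big_ord0 mact0l.
by rewrite !big_ord_recl mactDl IH.
Qed.

Lemma mact_sumr p q n (e : (p + q = n)%N) k x (F : 'I_k -> W q) :
  mact e x (\sum_i F i) = \sum_i mact e x (F i).
Proof.
elim: k F => [|k IH] F; first by rewrite !big_ord0 mact0r.
by rewrite !big_ord_recl mactDr IH.
Qed.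

(* (f g)_n = \sum_(i + j = n) f_i g_j *)
Definition conv (f : gsum R) (g : gsumM W) : gsumM W.
Proof.
exists (fun n => \sum_(i < n.+1) mact (subnKC (leq_ord i)) (f i) (g (n - i)%N)).
case: (coordP f) (coordP g) => [m fm] [k gk]; exists (m + k)%N => q mkq.
rewrite big1 // => i _; case: (leqP m i) => [/fm->|im]; first exact: mact0l.
rewrite gk ?mact0r // leq_subRL ?leq_ord //.
by apply: leq_trans mkq; rewrite leq_add2r ltnW.
Defined.

Lemma convDl f g h : conv (f + g) h = conv f h + conv g h.
Proof.
by apply: dsumP => q /=; rewrite -big_split; apply: eq_bigr => i _; apply: mactDl.
Qed.

Lemma convDr f g h : conv f (g + h) = conv f g + conv f h.
Proof.
by apply: dsumP => q /=; rewrite -big_split; apply: eq_bigr => i _; apply: mactDr.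
Qed.

Lemma conv1 f : conv (dsum_in (rone R)) f = f.
Proof.
apply: dsumP => n /=; rewrite (bigD1 ord0) //= big1 => [|i i0]; last first.
  by rewrite dfwith_out ?mact0l // eq_sym.
rewrite addr0 dfwith_in.
move: (subnKC _) => e; rewrite /= in e *.
by move: e; rewrite subn0 => e; rewrite mact1.
Qed.

End Convolution.

Definition regmod (R : gradedRing) : gradedModule R :=
  GradedModule (@rmulDl R) (@rmulDr R) (@rmulA R) (@rmul1l R).

Lemma convA (R : gradedRing) (W : gradedModule R) (f g : gsum R) (h : gsumM W) :
  conv f (conv g h) = conv (conv (W := regmod R) f g) h.
Proof.
apply: dsumP => n /=.
pose T i j k : W n :=
  if (i + j + k =P n)%N is ReflectT e
  then mact e (rmul erefl (f i) (g j)) (h k) else 0.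
transitivity (\sum_(i < n.+1) \sum_(j < (n - i).+1) T i j (n - i - j)%N).
  apply: eq_bigr => i _; rewrite mact_sumr; apply: eq_bigr => j _.
  rewrite /T; case: eqP => [e|[]]; first exact: mactA.
  by rewrite -addnA !subnKC ?leq_ord.
rewrite triangular_sum3; apply: eq_bigr => i _.
rewrite mact_suml; apply: eq_bigr => j _.
rewrite /T; case: eqP => [e|[]]; last by rewrite !subnKC ?leq_ord.
have e3 : (i - j + (n - i) = n - j)%N.
  by rewrite addnC addnBA ?leq_ord // subnK ?leq_ord.
have e4 : (j + (n - j) = n)%N.
  by rewrite subnKC // (leq_trans (leq_ord j)) ?leq_ord.
by rewrite -(mactA (subnKC (leq_ord j)) _ e3 e4) -(mactA erefl e e3 e4).
Qed.

Section GradedRingTheory.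
Variable R : gradedRing.

Definition gmul (f g : gsum R) : gsum R := conv (W := regmod R) f g.

Lemma gmulA : associative gmul.
Proof. by move=> f g h; exact: (convA (W := regmod R)). Qed.
Lemma gmul1l : left_id (dsum_in (rone R)) gmul.
Proof. by move=> f; exact: (conv1 (W := regmod R)). Qed.
Lemma gmul1r : right_id (dsum_in (rone R)) gmul.
Proof.
move=> f; apply: dsumP => n /=; rewrite (bigD1 ord_max) //= big1 => [|i im].
  move: (subnKC _) => e; rewrite /= in e *; move: e.
  rewrite subnn => e.
  by rewrite dfwith_in rmul1r; exact: addr0.
rewrite dfwith_out; first exact: (@mact0r _ (regmod R)).
by rewrite eq_sym subn_eq0 -ltnNge ltn_neqAle im leq_ord.
Qed.
Lemma gmulDl : left_distributive gmul +%R.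
Proof. by move=> f g h; exact: (convDl (W := regmod R)). Qed.
Lemma gmulDr : right_distributive gmul +%R.
Proof. by move=> f g h; exact: (convDr (W := regmod R)). Qed.

HB.instance Definition _ :=
  GRing.Zmodule_isPzRing.Build (gsum R) gmulA gmul1l gmul1r gmulDl gmulDr.

Variable W : gradedModule R.

Lemma gactA (f g : gsum R) (h : gsumM W) : conv f (conv g h) = conv (f * g) h.
Proof. exact: convA. Qed.
Lemma gact1 : left_id (1 : gsum R) (@conv R W).
Proof. by move=> f; exact: conv1. Qed.
Lemma gactDr : right_distributive (@conv R W) +%R.
Proof. by move=> f g h; exact: convDr. Qed.
Lemma gactDl (v : gsumM W) : {morph (@conv R W)^~ v : f g / f + g}.
Proof. by move=> f g; exact: convDl. Qed.

HB.instance Definition _ :=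
  GRing.Zmodule_isLmodule.Build (gsum R) (gsumM W) gactA gact1 gactDr gactDl.

End GradedRingTheory.

Definition generates (R : pzRingType) (V : lmodType R) (S : {fset V}) :=
  forall v : V, exists c : V -> R, v = \sum_(x <- S) c x *: x.

Definition minimal_homogeneous_generating_set
    (R : gradedRing) (W : gradedModule R) (S : {fset gsumM W}) :=
  [/\ {in S, forall x, homogeneous x},
      generates S
    & forall S' : {fset gsumM W}, S' `<` S -> ~ generates S'].

Record zfiltration (V : zmodType) := ZFiltration {
  zfil :> nat -> {pred V};
  zfil_zmod : forall q, zmod_closed (zfil q);
  zfil_mono : forall q, {subset zfil q <= zfil q.+1}
}.

Record algFiltration (K : fieldType) (A : algType K) := AlgFiltration {
  algfil :> zfiltration A;
  algfilZ : forall p (k : K) x, x \in algfil p -> k *: x \in algfil p;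
  algfil1 : 1 \in algfil 0;
  algfilM : forall p q x y,
    x \in algfil p -> y \in algfil q -> x * y \in algfil (p + q)%N
}.

Record modFiltration (K : fieldType) (A : algType K) (FA : algFiltration A)
    (M : lmodType A) := ModFiltration {
  modfil :> zfiltration M;
  modfilM : forall p q x v,
    x \in FA p -> v \in modfil q -> x *: v \in modfil (p + q)%N
}.

Record filteredModule (K : fieldType) (A : algType K) (FA : algFiltration A)
    (M : lmodType A) := FilteredModule {
  fmfil :> modFiltration FA M;
  fmfilZ : forall q (k : K) v, v \in fmfil q -> k%:A *: v \in fmfil q;
  fmfil_exhaustive : forall v, exists q, v \in fmfil q
}.

Section GradedParts.
Variables (V : zmodType) (F : zfiltration V).

(* F_{q-1}, with F_{-1} = 0 *)
Definition zprev q : {pred V} := if q is q'.+1 then F q' else pred1 0.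

HB.instance Definition _ q := GRing.isZmodClosed.Build V (zfil F q) (zfil_zmod F q).

Record rees_part q := ReesPart { rval : V; _ : rval \in F q }.

HB.instance Definition _ q := [isSub for @rval q].
HB.instance Definition _ q := [Choice of rees_part q by <:].
HB.instance Definition _ q := [SubChoice_isSubZmodule of rees_part q by <:].

Definition lower q : {pred rees_part q} := [pred x | val x \in zprev q].

Lemma lower_closed q : zmod_closed (@lower q).
Proof.
rewrite /lower; case: q => [|q]; split=> [|x y]; rewrite !inE ?raddf0 ?rpred0 //=.
  by move=> /eqP-> /eqP->; rewrite subr0.
by rewrite /zprev => ? ?; exact: rpredB.
Qed.

HB.instance Definition _ q :=
  GRing.isZmodClosed.Build (rees_part q) (@lower q) (@lower_closed q).

(* the element x of F_q, as an element of the type rees_part q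
   (junk value 0 if x is not in F_q) *)
Definition in_part q (x : V) : rees_part q := insubd 0 x.

(* d_fil(x), for 0 != x in the union of the F_q *)
Definition dfil (x : V) : nat :=
  xget 0%N (fun q => x \in F q /\ x \notin zprev q).

End GradedParts.

(* F_q / F_{q-1} *)
Notation gr_part F q := (Quotient.quot (lower (F := F) (q := q))).

Section GradedPartsTheory.
Variables (V : zmodType) (F : zfiltration V).

Lemma gr_eq q (x y : rees_part F q) :
  val x - val y \in zprev F q -> \pi_(gr_part F q) x = \pi_(gr_part F q) y.
Proof. by move=> xy; apply/eqP; rewrite -Quotient.idealrBE inE raddfB. Qed.

Lemma gr_repr q (x : rees_part F q) :
  val (repr (\pi_(gr_part F q) x)) - val x \in zprev F q.
Proof.
have /eqP := reprK (\pi_(gr_part F q) x).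
by rewrite -Quotient.idealrBE inE raddfB.
Qed.

Lemma zprevD q x y :
  x \in zprev F q -> y \in zprev F q -> x + y \in zprev F q.
Proof.
case: q => [|q] /=; last exact: rpredD.
by rewrite !inE => /eqP-> /eqP->; rewrite addr0.
Qed.

Lemma gr_piD q (x y : rees_part F q) :
  \pi_(gr_part F q) (x + y) = \pi_(gr_part F q) x + \pi_(gr_part F q) y.
Proof. exact: raddfD. Qed.

End GradedPartsTheory.

Section GradedAlgebra.
Variables (K : fieldType) (A : algType K) (FA : algFiltration A).

Definition rees_mul p q n (e : (p + q = n)%N)
    (x : rees_part FA p) (y : rees_part FA q) : rees_part FA n.
Proof.
by exists (val x * val y); rewrite -e; apply: algfilM; apply: valP.
Defined.

(* the Rees algebra is gsum rees_ring, the associated graded algebra is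
   gsum gr_ring; likewise gsumM rees_module and gsumM gr_module *)
Definition rees_ring : gradedRing.
Proof.
apply: (@GradedRing (rees_part FA) (ReesPart (algfil1 FA)) rees_mul).
- by move=> p q n e x y z; apply: val_inj; rewrite /= mulrDl.
- by move=> p q n e x y z; apply: val_inj; rewrite /= mulrDr.
- by move=> *; apply: val_inj; rewrite /= mulrA.
- by move=> *; apply: val_inj; rewrite /= mul1r.
- by move=> *; apply: val_inj; rewrite /= mulr1.
Defined.

(* (x + F_{p-1}A)(y + F_{q-1}A) = xy + F_{p+q-1}A *)
Definition gr_mul p q n (e : (p + q = n)%N)
    (x : gr_part FA p) (y : gr_part FA q) : gr_part FA n :=
  \pi_(gr_part FA n) (rees_mul e (repr x) (repr y)).

Lemma zprevMl p q n (e : (p + q = n)%N) x y :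
  x \in zprev FA p -> y \in FA q -> x * y \in zprev FA n.
Proof.
case: _ / e; case: p => [|p] /=; last exact: algfilM.
by rewrite inE => /eqP-> _; rewrite mul0r; case: q => [|q] /=; rewrite ?inE ?rpred0.
Qed.

Lemma zprevMr p q n (e : (p + q = n)%N) x y :
  x \in FA p -> y \in zprev FA q -> x * y \in zprev FA n.
Proof.
case: _ / e; case: q => [|q] /=; last by rewrite addnS; exact: algfilM.
by rewrite inE => _ /eqP->; rewrite mulr0; case: p => [|p] /=; rewrite ?inE ?rpred0.
Qed.

Lemma gr_mulE p q n (e : (p + q = n)%N) x y :
  gr_mul e (\pi x) (\pi y) = \pi_(gr_part FA n) (rees_mul e x y).
Proof.
apply: gr_eq => /=.
set x' := repr _; set y' := repr _.
have -> : rval x' * rval y' - rval x * rval y =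
          (rval x' - rval x) * rval y' + rval x * (rval y' - rval y).
  by rewrite mulrBl mulrBr addrA subrK.
apply: zprevD; [apply: (zprevMl e)|apply: (zprevMr e)].
- exact: gr_repr.
- exact: valP.
- exact: valP.
- exact: gr_repr.
Qed.

Definition gr_ring : gradedRing.
Proof.
apply: (@GradedRing (fun p => gr_part FA p)
          (\pi_(gr_part FA 0%N) (rone rees_ring)) gr_mul).
- move=> p q n e x y z; rewrite -[x]reprK -[y]reprK -[z]reprK.
  by rewrite -gr_piD !gr_mulE -gr_piD; congr \pi; exact: (rmulDl (g := rees_ring)).
- move=> p q n e x y z; rewrite -[x]reprK -[y]reprK -[z]reprK.
  by rewrite -gr_piD !gr_mulE -gr_piD; congr \pi; exact: (rmulDr (g := rees_ring)).
- move=> p q r s t n e1 e2 e3 e4 x y z.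
  rewrite -[x]reprK -[y]reprK -[z]reprK !gr_mulE.
  by congr \pi; exact: (rmulA (g := rees_ring)).
- move=> q e x; rewrite -[x]reprK gr_mulE.
  by congr \pi; exact: (rmul1l (g := rees_ring)).
- move=> q e x; rewrite -[x]reprK gr_mulE.
  by congr \pi; exact: (rmul1r (g := rees_ring)).
Defined.

Variables (M : lmodType A) (F : modFiltration FA M).

Definition rees_act p q n (e : (p + q = n)%N)
    (x : rees_part FA p) (v : rees_part F q) : rees_part F n.
Proof.
by exists (val x *: val v); rewrite -e; apply: modfilM; apply: valP.
Defined.

Definition rees_module : gradedModule rees_ring.
Proof.
apply: (@GradedModule rees_ring (rees_part F) rees_act).
- by move=> p q n e x y v; apply: val_inj; rewrite /= scalerDl.
- by move=> p q n e x u v; apply: val_inj; rewrite /= scalerDr.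
- by move=> *; apply: val_inj; rewrite /= scalerA.
- by move=> *; apply: val_inj; rewrite /= scale1r.
Defined.

Definition gr_act p q n (e : (p + q = n)%N)
    (x : gr_part FA p) (v : gr_part F q) : gr_part F n :=
  \pi_(gr_part F n) (rees_act e (repr x) (repr v)).

Lemma zprevZl p q n (e : (p + q = n)%N) x v :
  x \in zprev FA p -> v \in F q -> x *: v \in zprev F n.
Proof.
case: _ / e; case: p => [|p] /=; last exact: modfilM.
by rewrite inE => /eqP-> _; rewrite scale0r; case: q => [|q] /=; rewrite ?inE ?rpred0.
Qed.

Lemma zprevZr p q n (e : (p + q = n)%N) x v :
  x \in FA p -> v \in zprev F q -> x *: v \in zprev F n.
Proof.
case: _ / e; case: q => [|q] /=; last by rewrite addnS; exact: modfilM.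
by rewrite inE => _ /eqP->; rewrite scaler0; case: p => [|p] /=; rewrite ?inE ?rpred0.
Qed.

Lemma gr_actE p q n (e : (p + q = n)%N) x v :
  gr_act e (\pi x) (\pi v) = \pi_(gr_part F n) (rees_act e x v).
Proof.
apply: gr_eq => /=.
set x' := repr _; set v' := repr _.
have -> : rval x' *: rval v' - rval x *: rval v =
          (rval x' - rval x) *: rval v' + rval x *: (rval v' - rval v).
  by rewrite scalerBl scalerBr addrA subrK.
apply: zprevD; [apply: (zprevZl e)|apply: (zprevZr e)].
- exact: gr_repr.
- exact: valP.
- exact: valP.
- exact: gr_repr.
Qed.

Definition gr_module : gradedModule gr_ring.
Proof.
apply: (@GradedModule gr_ring (fun q => gr_part F q) gr_act).
- move=> p q n e x y v; rewrite -[x]reprK -[y]reprK -[v]reprK.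
  by rewrite -gr_piD !gr_actE -gr_piD; congr \pi; exact: (mactDl (g := rees_module)).
- move=> p q n e x u v; rewrite -[x]reprK -[u]reprK -[v]reprK.
  by rewrite -gr_piD !gr_actE -gr_piD; congr \pi; exact: (mactDr (g := rees_module)).
- move=> p q r s t n e1 e2 e3 e4 x y v.
  transitivity (gr_act e2 (gr_mul e1 x y) v); last by [].
  rewrite -[x]reprK -[y]reprK -[v]reprK gr_mulE !gr_actE.
  by congr \pi; exact: (mactA (g := rees_module)).
- move=> q e v; rewrite -[v]reprK -[rone _]/(\pi_(gr_part FA 0%N) (rone rees_ring)) gr_actE.
  by congr \pi; exact: (mact1 (g := rees_module)).
Defined.

(* sigma is not injective in general: x and x + y have the same symbol as soon
   as y has a smaller filtered degree than x *)
Definition sigma (x : M) : gsumM gr_module :=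
  dsum_in (V := gr_module) (\pi_(gr_part F (dfil F x)) (in_part F (dfil F x) x)).

Definition tau (x : M) : gsumM rees_module :=
  dsum_in (V := rees_module) (in_part F (dfil F x) x).

End GradedAlgebra.

Section StandardBases.
Variables (K : fieldType) (A : algType K) (FA : algFiltration A).
Variables (M : lmodType A) (FM : modFiltration FA M).
Variables (N : {pred M}) (N_sub : submod_closed N).

(* F_q N = N :&: F_q M *)
Definition induced_zfiltration : zfiltration M.
Proof.
apply: (@ZFiltration M (fun q => [pred v | (v \in N) && (v \in FM q)])) => q.
  have [N0 ND] := N_sub; have [F0 FB] := zfil_zmod FM q.
  split=> [|u v]; rewrite !inE ?N0 ?F0 // => /andP[Nu Fu] /andP[Nv Fv].
  by rewrite FB // addrC -scaleN1r ND.
by move=> v; rewrite !inE => /andP[-> /zfil_mono].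
Defined.

Definition induced_filtration : modFiltration FA M.
Proof.
apply: (@ModFiltration K A FA M induced_zfiltration) => p q x v Fx.
rewrite !inE => /andP[Nv Fv]; rewrite modfilM // andbT.
by have [N0 ND] := N_sub; rewrite -[_ *: _]addr0 ND.
Defined.

(* n_xi is some natural number attached to xi, a priori unrelated to dfil xi:
   F_q N = \sum_(xi in W) (\sum_(p + n_xi <= q) F_p A) xi for all q *)
Definition standard_basis (W : {fset M}) :=
  [/\ {subset W <= N}, 0 \notin W
    & exists n : M -> nat, forall q v,
        v \in induced_filtration q <->
        exists2 b : M -> nat -> A,
          forall xi p, xi \in W -> (p + n xi <= q)%N -> b xi p \in FA p
        & v = \sum_(xi <- W) (\sum_(p < q.+1 | (p + n xi <= q)%N) b xi p) *: xi].

Definition minimal_standard_basis (W : {fset M}) :=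
  standard_basis W /\
  forall W' : {fset M}, W' `<` W -> ~ standard_basis W'.

End StandardBases.

Section SolvablePolynomialAlgebras.
Variables (K : fieldType) (A : algType K) (n : nat) (a : 'I_n -> A).

Definition expo := {ffun 'I_n -> nat}.

Implicit Types alpha beta gamma eta mu nu : expo.

(* the product is taken in increasing order of the indices *)
Definition mon alpha : A := \prod_(i < n) a i ^+ alpha i.

Definition lincomb (c : {fsfun expo -> K with 0}) : A :=
  \sum_(alpha <- finsupp c) c alpha *: mon alpha.

Definition generates_algebra (X : {fset A}) :=
  forall S : {pred A}, subalg_closed S -> {subset X <= S} -> forall x, x \in S.

Section LeadingMonomials.
Variable le : rel expo.

Definition prec : rel expo := fun alpha beta => (alpha != beta) && le alpha beta.

(* LM(f) = a^mu; the monomials are identified with their exponents, which is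
   meaningful since they form a basis *)
Definition is_LM (f : A) mu := exists c : {fsfun expo -> K with 0},
  [/\ f = lincomb c, mu \in finsupp c & {in finsupp c, forall nu, le nu mu}].

Definition is_const (x : A) := exists k : K, x = k%:A.

Record solvable_polynomial_algebra : Prop := SolvablePolynomialAlgebra {
  spa_generates : generates_algebra [fset a i | i in 'I_n];
  spa_min_generates : forall X : {fset A},
    X `<` [fset a i | i in 'I_n] -> ~ generates_algebra X;
  spa_basis : forall f : A, exists! c : {fsfun expo -> K with 0}, f = lincomb c;
  spa_total : total_order le;
  spa_well : well_order le;
  spa_mono : forall alpha beta gamma eta mu nu,
    prec alpha beta ->
    is_LM (mon gamma * mon alpha * mon eta) mu -> ~ is_const (mon mu) ->
    is_LM (mon gamma * mon beta * mon eta) nu -> ~ is_const (mon nu) ->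
    prec mu nu;
  spa_div : forall alpha beta gamma eta,
    mon beta <> mon gamma -> is_LM (mon alpha * mon beta * mon eta) gamma ->
    prec beta gamma;
  spa_mul : forall alpha beta, exists (lambda : K) (f : A),
    [/\ lambda != 0,
        mon alpha * mon beta = lambda *: mon (alpha + beta) + f
      & f = 0 \/ exists2 mu, is_LM f mu & prec mu (alpha + beta)]
}.

End LeadingMonomials.

Variable d : 'I_n -> nat.

Definition wdeg alpha : nat := \sum_(i < n) d i * alpha i.

(* F_p A = K-span {a^alpha | d(a^alpha) <= p} *)
Definition wfil p : {pred A} := fun f =>
  `[< exists2 c : {fsfun expo -> K with 0},
        {in finsupp c, forall alpha, (wdeg alpha <= p)%N} & f = lincomb c >].

Definition weighted_filtered := forall p q x y,
  x \in wfil p -> y \in wfil q -> x * y \in wfil (p + q).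

Lemma lincomb_sup (c : {fsfun expo -> K with 0}) (S : {fset expo}) :
  finsupp c `<=` S -> lincomb c = \sum_(alpha <- S) c alpha *: mon alpha.
Proof.
move=> cS; rewrite /lincomb; apply: big_fset_incl => // alpha _ cN.
by rewrite fsfun_dflt // scale0r.
Qed.

Lemma wfil_submod p : submod_closed (wfil p).
Proof.
split=> [|k x y /asboolP[c cp ->] /asboolP[e ep ->]]; apply/asboolP.
  by exists [fsfun]; rewrite /lincomb finsupp0 ?big_seq_fset0.
pose S := finsupp c `|` finsupp e.
pose g : {fsfun expo -> K with 0} := [fsfun alpha in S => k * c alpha + e alpha].
have gS : finsupp g `<=` S by exact: finsupp_sub.
exists g => [alpha /(fsubsetP gS)|].
  by rewrite inE => /orP[/cp|/ep].
rewrite (lincomb_sup gS) (lincomb_sup (fsubsetUl _ (finsupp e))).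
rewrite (lincomb_sup (fsubsetUr (finsupp c) _)) scaler_sumr -big_split /=.
rewrite big_seq [RHS]big_seq; apply: eq_bigr => alpha alphaS.
by rewrite fsfunE alphaS scalerDl scalerA.
Qed.

Lemma wfil_mono p : {subset wfil p <= wfil p.+1}.
Proof.
move=> x /asboolP[c cp ->]; apply/asboolP; exists c => // alpha /cp.
exact: leqW.
Qed.

Lemma wfil1 : 1 \in wfil 0.
Proof.
apply/asboolP; pose c : {fsfun expo -> K with 0} := [fsfun alpha in [fset 0] => 1].
have cS : finsupp c `<=` [fset 0] by exact: finsupp_sub.
exists c => [alpha /(fsubsetP cS)|].
  by rewrite inE => /eqP->; rewrite /wdeg big1 // => i _; rewrite ffunE muln0.
rewrite (lincomb_sup cS) big_seq_fset1 fsfunE inE eqxx scale1r /mon.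
by rewrite big1 // => i _; rewrite ffunE expr0.
Qed.

Lemma wfil_zmod p : zmod_closed (wfil p).
Proof.
have [W0 WD] := wfil_submod p; split=> // x y Wx Wy.
by rewrite -scaleN1r addrC WD.
Qed.

Lemma wfilZ p (k : K) x : x \in wfil p -> k *: x \in wfil p.
Proof. by have [W0 WD] := wfil_submod p => Wx; rewrite -[_ *: _]addr0 WD. Qed.

Definition weighted_filtration (FA_mul : weighted_filtered) : algFiltration A :=
  @AlgFiltration K A (ZFiltration wfil_zmod wfil_mono) wfilZ wfil1 FA_mul.

End SolvablePolynomialAlgebras.

(* Main.v *)
Require Import Defs.
From HB Require Import structures.
From mathcomp Require Import all_boot all_order all_algebra.
From mathcomp Require Import finmap.
From mathcomp Require Import boolp classical_sets wochoice.

Set Implicit Arguments.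
Unset Strict Implicit.
Unset Printing Implicit Defensive.

Import GRing.Theory.
Local Open Scope fset_scope.
Local Open Scope quotient_scope.
Local Open Scope ring_scope.

(** All three notions of generation in the theorem say the same thing about the
    filtration FN of N.  Write d for the filtered degree and call W a set of
    filtered generators if every v in F_q N is a combination of the xi in W with
    coefficients in F_{q - d(xi)} A (no coefficient when d(xi) > q).

    - W is a standard basis iff it generates FN in this sense
      ([standard_basisP]): whatever integers n_xi witness a standard basis, xi
      itself lies in F_{n_xi} N, so that n_xi >= d(xi), and replacing n_xi by
      d(xi) only allows more coefficients.
    - A graded module is generated by homogeneous elements iff each of its
      homogeneous parts is ([homogeneous_span]).  For the Rees module, the
      condition in degree q is literally the one on F_q N ([generates_tau]).
      For the associated graded module it is that condition modulo F_{q-1} N,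
      and induction on q removes the error term ([generates_sigma]).

    Minimality is then compared on subsets.  The map tau is injective on nonzero
    elements.  The map sigma is not, but it is injective on a minimal W, since
    an element that shares its symbol with another one could be dropped.

    For the count, positivity of the weights gives F_0 A = K, which makes a
    graded Nakayama argument work.  Let U_q be the part of F_q N generated by the
    elements of W of degree less than q.  Any two sets of filtered generators
    have the same U_q ([lower_part_span]), and for a minimal W the elements of
    degree q form a K-basis of F_q N modulo U_q: they span because their
    coefficients lie in F_0 A = K ([degree_part_spans]), and a nontrivial
    relation would express one of them by the rest of W ([degree_part_free]).
    Hence their number is the dimension of F_q N / U_q, and summing over q gives
    the number of all elements. *)

(** * Spans with constrained coefficients *)

Section ConstrainedSpan.
Variables (R : pzRingType) (V : lmodType R) (I : choiceType).
Variable C : I -> {pred R}.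
Implicit Types (W : {fset I}) (f : I -> V).

(** The coefficient of [f i] is restricted to [C i]: with [C] everything this is
    the submodule generated by a family, and with [C i] a step of the filtration
    of the ring it is a step of the filtration that the family generates. *)
Definition coef_span W f (v : V) :=
  exists2 c : I -> R, {in W, forall i, c i \in C i}
                    & v = \sum_(i <- W) c i *: f i.

Hypothesis C_zmod : forall i, zmod_closed (C i).

Lemma coef_span0 W f : coef_span W f 0.
Proof.
exists (fun=> 0) => [i _|]; first by have [] := C_zmod i.
by rewrite big1 // => i _; rewrite scale0r.
Qed.

Lemma coef_spanB W f u v :
  coef_span W f u -> coef_span W f v -> coef_span W f (u - v).
Proof.
move=> [b bC ->] [c cC ->]; exists (fun i => b i - c i) => [i iW|].
  by have [_ CB] := C_zmod i; rewrite CB ?bC ?cC.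
by rewrite -sumrB; apply: eq_bigr => i _; rewrite scalerBl.
Qed.

Lemma coef_spanD W f u v :
  coef_span W f u -> coef_span W f v -> coef_span W f (u + v).
Proof.
move=> su sv; rewrite -[v]opprK -[- v]add0r.
by apply: coef_spanB => //; apply: coef_spanB => //; apply: coef_span0.
Qed.

Lemma coef_span_sum W f (J : eqType) (s : seq J) (P : pred J) (g : J -> V) :
  {in s, forall j, P j -> coef_span W f (g j)} ->
  coef_span W f (\sum_(j <- s | P j) g j).
Proof.
move=> sg; rewrite big_seq_cond; apply: big_ind => [||j /andP[]].
- exact: coef_span0.
- by move=> u v; apply: coef_spanD.
- exact: sg.
Qed.

Lemma coef_span_gen W f i x :
  i \in W -> x \in C i -> coef_span W f (x *: f i).
Proof.
move=> iW xC; exists (fun j => if j == i then x else 0) => [j _|].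
  by case: eqP => [->//|_]; have [] := C_zmod j.
rewrite (big_fsetD1 i) //= eqxx big_seq big1 ?addr0 // => j.
by rewrite !inE => /andP[/negPf-> _]; rewrite scale0r.
Qed.

End ConstrainedSpan.

(** A family and its image generate the same submodule even when the family
    repeats elements, which is the case for the symbols of a set. *)
Lemma generates_imfset (R : pzRingType) (V : lmodType R) (I : choiceType)
    (W : {fset I}) (f : I -> V) :
  generates [fset f i | i in W] <->
  forall v, coef_span (fun=> predT) W f v.
Proof.
have T_zmod (J : Type) (j : J) : zmod_closed (predT : {pred R}) by [].
split=> [gen v|span v].
  have [c ->] := gen v; apply: coef_span_sum => // x /imfsetP[i /= iW ->] _.
  exact: coef_span_gen.
have [c _ ->] := span v.
have [e _ ->] : coef_span (fun=> predT) [fset f i | i in W] id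
                   (\sum_(i <- W) c i *: f i); last by exists e.
apply: coef_span_sum => // i iW _; apply: (coef_span_gen _ id) => //.
by apply/imfsetP; exists i.
Qed.

(** * Generation by homogeneous elements, degree by degree *)

Section HomogeneousGeneration.
Variables (R : gradedRing) (L : gradedModule R).

(** The action of the part of degree q - n on an element of degree n, landing in
    degree q.  For n > q the truncated difference q - n would be 0, but the part
    of negative degree of the ring is zero, so the product is 0. *)
Definition homog_act n q (x : R (q - n)%N) (u : L n) : L q :=
  if @idP (n <= q)%N is ReflectT nq then mact (subnK nq) x u else 0.

Lemma coord_sum (V : nat -> zmodType) (J : Type) (s : seq J) (g : J -> dsum V) q :
  (\sum_(j <- s) g j) q = \sum_(j <- s) g j q.
Proof. exact: (big_morph (fun f : dsum V => f q)). Qed.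

Lemma dsum_inD (V : nat -> zmodType) q : {morph @dsum_in V q : u v / u + v}.
Proof.
move=> u v; apply: dsumP => k /=.
have [<-|qk] := eqVneq q k; first by rewrite !dfwith_in.
by rewrite !dfwith_out // addr0.
Qed.

Lemma dsum_in0 (V : nat -> zmodType) q : dsum_in (0 : V q) = 0.
Proof.
apply: dsumP => k /=; have [<-|qk] := eqVneq q k; first by rewrite dfwith_in.
by rewrite dfwith_out.
Qed.

Lemma dsum_in_sum (V : nat -> zmodType) q (J : Type) (s : seq J) (g : J -> V q) :
  dsum_in (\sum_(j <- s) g j) = \sum_(j <- s) dsum_in (g j).
Proof. exact: (big_morph _ (@dsum_inD V q) (dsum_in0 V q)). Qed.

Lemma dsum_decomp (V : nat -> zmodType) (f : dsum V) :
  exists m, f = \sum_(q < m) dsum_in (f q).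
Proof.
have [m fm] := coordP f; exists m; apply: dsumP => k; rewrite coord_sum.
have [km|mk] := ltnP k m; last first.
  rewrite fm // big1 // => q _ /=; rewrite dfwith_out //.
  by rewrite ltn_eqF // (leq_trans (ltn_ord q)).
rewrite (bigD1 (Ordinal km)) //= dfwith_in big1 ?addr0 // => q qk.
by rewrite dfwith_out.
Qed.

Lemma conv_dsum_in (f : gsum R) n (u : L n) q :
  (f *: (dsum_in u : gsumM L)) q = homog_act (f (q - n)%N) u.
Proof.
rewrite /homog_act; case: {-}_ / idP => [nq|/negP]; rewrite /=.
  have iq : (q - n < q.+1)%N by rewrite ltnS leq_subr.
  rewrite (bigD1 (Ordinal iq)) //= big1 ?addr0 => [|j jq].
    (* q - (q - n) is only provably equal to n: generalize it before using the
       equality to identify the two types *)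
    move: (subnKC _) (subnK nq) => /=; move: (q - (q - n))%N (subKn nq) => m.
    by move=> /esym mn; case: _ / mn => e e'; rewrite dfwith_in (Prop_irrelevance e e').
  rewrite dfwith_out ?mact0r //; apply: contra jq => /eqP nqj; apply/eqP/val_inj.
  by rewrite /= nqj subKn // leq_ord.
rewrite -ltnNge => qn; apply: big1 => j _; rewrite dfwith_out ?mact0r //.
by rewrite gtn_eqF // (leq_ltn_trans _ qn) // leq_subr.
Qed.

Lemma homog_act_dsum_in n q (x : R (q - n)%N) (u : L n) :
  dsum_in (homog_act x u) =
  ((if (n <= q)%N then dsum_in x else 0) : gsum R) *: (dsum_in u : gsumM L).
Proof.
apply: dsumP => k; rewrite conv_dsum_in.
have [qn|nq] := ltnP q n.
  rewrite /homog_act; case: {-}_ / idP => [nq|_]; first by have := nq; rewrite leqNgt qn.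
  rewrite dsum_in0 /=; case: {-}_ / idP => [nk|//]; by rewrite mact0l.
rewrite /=; have [<-|qk] := eqVneq q k; first by rewrite !dfwith_in.
rewrite dfwith_out // /homog_act; case: {-}_ / idP => [nk|//].
rewrite dfwith_out ?mact0l //; apply: contra qk => /eqP qnk.
by rewrite -(subnK nq) qnk subnK.
Qed.

(** Only the component of degree q - delta i of the i-th coefficient contributes
    to degree q, so generators of the module span each homogeneous part by
    homogeneous coefficients.  Conversely an element is the sum of its homogeneous components. *)
Lemma homogeneous_span (I : choiceType) (W : {fset I}) (delta : I -> nat)
    (u : forall i, L (delta i)) :
  (forall v, coef_span (fun=> predT) W (fun i => dsum_in (u i) : gsumM L) v) <->
  forall q (v : L q), exists b : forall i, R (q - delta i)%N,
    v = \sum_(i <- W) homog_act (b i) (u i).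
Proof.
have T_zmod (i : I) : zmod_closed (predT : {pred gsum R}) by [].
split=> [span q v|span f].
  have [c _ vE] := span (dsum_in v).
  exists (fun i => c i (q - delta i)%N).
  transitivity ((dsum_in v : gsumM L) q); first by rewrite /= dfwith_in.
  by rewrite vE coord_sum; apply: eq_bigr => i _; apply: conv_dsum_in.
have [m ->] := dsum_decomp f; apply: coef_span_sum => // q _ _.
have [b ->] := span q (f q); rewrite dsum_in_sum.
apply: coef_span_sum => // i iW _; rewrite homog_act_dsum_in.
exact: (coef_span_gen _ (fun i => dsum_in (u i) : gsumM L)).
Qed.

End HomogeneousGeneration.
(** * Generators of a filtration, of its Rees module and of its graded module *)

Section FilteredSpan.
Variables (K : fieldType) (A : algType K) (FA : algFiltration A).
Variables (M : lmodType A) (F : modFiltration FA M).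
Implicit Types (W X Y : {fset M}) (xi v : M).

Lemma zfil_le (V : zmodType) (G : zfiltration V) p q :
  (p <= q)%N -> {subset G p <= G q}.
Proof.
move=> /subnK<-; elim: (q - p)%N => // k IH x /IH.
exact: zfil_mono.
Qed.

Lemma dfilP q xi : xi \in F q -> xi != 0 ->
  xi \in F (dfil F xi) /\ xi \notin zprev F (dfil F xi).
Proof.
move=> xiq xi0; apply: (xgetPex 0%N (P := fun q => xi \in F q /\ xi \notin zprev F q)).
have exF : exists q, xi \in F q by exists q.
case: (ex_minnP exF) => -[|p] xip minp; first by exists 0%N.
by exists p.+1; split=> //; apply/negP => /minp; rewrite ltnn.
Qed.

Lemma dfil_le q xi : xi \in F q -> xi != 0 -> (dfil F xi <= q)%N.
Proof.
move=> xiq xi0; have [_] := dfilP xiq xi0.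
case: (dfil F xi) => // p; rewrite ltnNge; apply: contra => qp.
exact: zfil_le xiq.
Qed.

(** This is F_{q-n} A, with F_p A = 0 for p < 0. *)
Definition shifted_fil q n : {pred A} :=
  if (n <= q)%N then FA (q - n)%N else pred1 0.

Lemma shifted_fil_zmod q n : zmod_closed (shifted_fil q n).
Proof.
rewrite /shifted_fil; case: ifP => _; first exact: zfil_zmod.
by split=> [|x y]; rewrite !inE // => /eqP-> /eqP->; rewrite subr0.
Qed.

Lemma shifted_filM p q n x y :
  x \in FA p -> y \in shifted_fil q n -> x * y \in shifted_fil (p + q) n.
Proof.
rewrite /shifted_fil => xp; have [nq yq|qn] := leqP n q.
  by rewrite (leq_trans nq (leq_addl _ _)) -addnBA // algfilM.
by rewrite !inE => /eqP->; rewrite mulr0; case: ifP => _; rewrite ?inE ?rpred0.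
Qed.

Definition fil_span W q v :=
  coef_span (fun xi => shifted_fil q (dfil F xi)) W id v.

Let sz q xi := shifted_fil_zmod q (dfil F xi).

Lemma fil_spanZ p q W x v :
  x \in FA p -> fil_span W q v -> fil_span W (p + q) (x *: v).
Proof.
move=> xp [c cW ->]; exists (fun xi => x * c xi) => [xi xiW|].
  exact: shifted_filM (cW _ xiW).
by rewrite scaler_sumr; apply: eq_bigr => xi _; rewrite scalerA.
Qed.

Lemma fil_span_self W xi : xi \in W -> fil_span W (dfil F xi) xi.
Proof.
move=> xiW; rewrite -[X in fil_span _ _ X]scale1r.
apply: (coef_span_gen (@sz _) id xiW).
by rewrite /shifted_fil leqnn subnn algfil1.
Qed.

(** Filtered degrees are additive along substitutions, so generators of
    generators are generators with no loss of degree. *)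
Lemma fil_span_trans X Y q v :
  {in X, forall xi, fil_span Y (dfil F xi) xi} ->
  fil_span X q v -> fil_span Y q v.
Proof.
move=> XY [c cX ->]; apply: (coef_span_sum (@sz _)) => xi xiX _.
have := cX _ xiX; rewrite /shifted_fil; case: leqP => [dq cq|_].
  by have := fil_spanZ cq (XY _ xiX); rewrite subnK.
by rewrite inE => /eqP->; rewrite scale0r; apply: (coef_span0 (@sz _)).
Qed.

(** Elements of degree greater than q have coefficient zero in a combination of
    degree q. *)
Lemma fil_span_restrict X Y q v :
  {in X, forall xi, (dfil F xi <= q)%N -> xi \in Y} ->
  fil_span X q v -> fil_span Y q v.
Proof.
move=> XY [c cX ->]; apply: (coef_span_sum (@sz _)) => xi xiX _.
have [dq|qd] := leqP (dfil F xi) q.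
  by apply: (coef_span_gen (@sz _) id); [exact: XY | exact: cX].
have := cX _ xiX; rewrite /shifted_fil leqNgt qd inE => /eqP->.
by rewrite scale0r; apply: (coef_span0 (@sz _)).
Qed.

Lemma fil_span_mono W q v : fil_span W q v -> fil_span W q.+1 v.
Proof.
move=> sv; rewrite -[v]scale1r; apply: (fil_spanZ (p := 1%N)) => //.
by apply: zfil_mono; apply: algfil1.
Qed.

Definition filtered_generators W := forall q v, v \in F q -> fil_span W q v.

Lemma in_part_val (V : zmodType) (G : zfiltration V) q x :
  x \in G q -> val (in_part G q x) = x.
Proof. exact: insubdK. Qed.

Lemma val_homog_act n q (x : rees_part FA (q - n)%N) (u : rees_part F n) :
  val (homog_act (L := rees_module F) x u : rees_part F q) =
  (if (n <= q)%N then val x else 0) *: val u.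
Proof.
rewrite /homog_act; case: {-}_ / idP => [nq|/negP/negPf nq].
  by move: (subnK nq) => e; rewrite nq.
by rewrite nq scale0r raddf0.
Qed.

(** Relations in the graded module are the residues of relations in the Rees
    module, so one computation with representatives serves both. *)
Lemma homog_act_pi n q (x : rees_part FA (q - n)%N) (u : rees_part F n) :
  homog_act (L := gr_module F) (\pi_(gr_part FA (q - n)%N) x) (\pi_(gr_part F n) u)
  = \pi_(gr_part F q) (homog_act (L := rees_module F) x u).
Proof.
rewrite /homog_act; case: {-}_ / idP => [nq|_]; first exact: gr_actE.
by rewrite raddf0.
Qed.

Section Symbols.
Variable W : {fset M}.
Hypothesis WF : {in W, forall xi, xi \in F (dfil F xi)}.

Lemma fil_span_homog_act q (b : forall xi, rees_part FA (q - dfil F xi)%N) :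
  fil_span W q (val (\sum_(xi <- W) homog_act (L := rees_module F) (b xi)
                       (in_part F (dfil F xi) xi) : rees_part F q)).
Proof.
exists (fun xi => if (dfil F xi <= q)%N then val (b xi) else 0) => [xi _|].
  by rewrite /shifted_fil; case: ifP => _; rewrite ?inE //; apply: valP.
rewrite raddf_sum big_seq [RHS]big_seq; apply: eq_bigr => xi xiW /=.
by rewrite val_homog_act in_part_val ?WF.
Qed.

Lemma fil_span_lift q (v : rees_part F q) : fil_span W q (val v) ->
  exists b : forall xi, rees_part FA (q - dfil F xi)%N,
    v = \sum_(xi <- W) homog_act (L := rees_module F) (b xi)
                         (in_part F (dfil F xi) xi).
Proof.
move=> [c cW vE]; exists (fun xi => in_part FA (q - dfil F xi)%N (c xi)).
apply: val_inj; rewrite vE raddf_sum big_seq [RHS]big_seq.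
apply: eq_bigr => xi xiW /=; rewrite val_homog_act (in_part_val (WF xiW)).
have := cW _ xiW; rewrite /shifted_fil; case: ifP => _ cq.
  by rewrite in_part_val.
by rewrite inE in cq; rewrite (eqP cq).
Qed.

(** The homogeneous part of degree q of the Rees module is F_q itself. *)
Lemma generates_tau :
  generates [fset tau F xi | xi in W] <-> filtered_generators W.
Proof.
split=> [/generates_imfset/homogeneous_span gen q v vq|gen].
  have [b] := gen q (in_part F q v).
  by move/(congr1 val); rewrite in_part_val // => ->; apply: fil_span_homog_act.
apply/generates_imfset/homogeneous_span => q v.
by apply: fil_span_lift; apply: gen; apply: valP.
Qed.

(** Lifting a relation between symbols gives a combination of the right degrees
    up to an error in F_{q-1}, which is treated by induction on q; the error
    vanishes at q = 0 because F_{-1} = 0. *)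
Lemma generates_sigma :
  generates [fset sigma F xi | xi in W] <-> filtered_generators W.
Proof.
split=> [/generates_imfset/homogeneous_span gen|gen]; last first.
  apply/generates_imfset/homogeneous_span => q v.
  have [|b vE] := @fil_span_lift q (repr v); first by apply: gen; apply: valP.
  exists (fun xi => \pi_(gr_part FA (q - dfil F xi)%N) (b xi)).
  rewrite -[v]reprK vE raddf_sum; apply: eq_bigr => xi _.
  by rewrite homog_act_pi.
have approx q v : v \in F q -> exists2 w, fil_span W q w & v - w \in zprev F q.
  move=> vq.
  have [b] := gen q (\pi_(gr_part F q) (in_part F q v)).
  set w := \sum_(xi <- W) homog_act (L := rees_module F) (repr (b xi))
             (in_part F (dfil F xi) xi) : rees_part F q.
  rewrite (_ : \sum_(_ <- _) _ = \pi_(gr_part F q) w); last first.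
    by rewrite raddf_sum; apply: eq_bigr => xi _; rewrite -[in LHS](reprK (b xi)) homog_act_pi.
  move/eqP; rewrite -Quotient.idealrBE inE raddfB /= in_part_val // => vw.
  by exists (val w) => //; apply: fil_span_homog_act.
elim=> [|q IH] v /approx[w sw]; first by rewrite inE subr_eq0 => /eqP->.
move=> vw; rewrite -(subrK w v); apply: (coef_spanD (@sz _)) => //.
by apply: fil_span_mono; apply: IH.
Qed.

End Symbols.

End FilteredSpan.

(** * Counting modulo a subspace *)

Section CountingModulo.
Variables (K : fieldType) (A : algType K) (V : lmodType A) (U : V -> Prop).
Hypotheses (U0 : U 0) (UD : forall u v, U u -> U v -> U (u + v)).
Hypothesis UZ : forall (k : K) u, U u -> U (k%:A *: u).

(** If x = P y and y = Q x modulo U then x = (P Q) x modulo U, so P Q = 1 by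
    independence of x; a product through K^k has rank at most k. *)
Lemma free_le_spanning_mod m k (x : 'I_m -> V) (y : 'I_k -> V) :
  (forall i, exists c : 'I_k -> K, U (x i - \sum_j (c j)%:A *: y j)) ->
  (forall j, exists c : 'I_m -> K, U (y j - \sum_i (c i)%:A *: x i)) ->
  (forall c : 'I_m -> K, U (\sum_i (c i)%:A *: x i) -> forall i, c i = 0) ->
  (m <= k)%N.
Proof.
move=> /choice[p xU] /choice[r yU] x_free.
pose P := \matrix_(i, j) p i j; pose Q := \matrix_(j, i) r j i.
suff PQ : P *m Q = 1%:M by apply: mulmx1_min PQ.
apply/matrixP => i l; apply/eqP; rewrite -subr_eq0 -oppr_eq0 opprB; apply/eqP.
move: l; apply: x_free.
have -> : \sum_l ((1%:M : 'M[K]_m) i l - (P *m Q) i l)%:A *: x l =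
    (x i - \sum_j (p i j)%:A *: y j) +
    \sum_j (p i j)%:A *: (y j - \sum_l (r j l)%:A *: x l).
  under [X in _ = _ + X]eq_bigr do rewrite scalerBr.
  rewrite sumrB addrA subrK.
  under eq_bigr do rewrite scalerBl scalerBl.
  rewrite sumrB; congr (_ - _).
    rewrite (bigD1 i) //= big1 => [|l li]; first by rewrite mxE eqxx !scale1r addr0.
    by rewrite mxE eq_sym (negPf li) !scale0r.
  under [RHS]eq_bigr do rewrite scaler_sumr.
  rewrite exchange_big; apply: eq_bigr => l _ /=.
  rewrite mxE !scaler_suml; apply: eq_bigr => j _.
  by rewrite !mxE scalerA -scalerAl mul1r scalerA.
by apply: UD => //; apply: big_ind => // j _; apply: UZ.
Qed.

Lemma free_le_spanning_mod_fset (X Y : {fset V}) :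
  {in X, forall x, exists c : V -> K, U (x - \sum_(y <- Y) (c y)%:A *: y)} ->
  {in Y, forall y, exists c : V -> K, U (y - \sum_(x <- X) (c x)%:A *: x)} ->
  (forall c : V -> K, U (\sum_(x <- X) (c x)%:A *: x) ->
    {in X, forall x, c x = 0}) ->
  (#|` X| <= #|` Y|)%N.
Proof.
have sumE (Z : {fset V}) (c : V -> K) : \sum_(z <- Z) (c z)%:A *: z =
    \sum_(i < #|` Z|) (c (nth 0 Z i))%:A *: nth 0 Z i.
  by rewrite (big_nth 0) big_mkord.
move=> XY YX X_free.
apply: (@free_le_spanning_mod _ _ (fun i => nth 0 X i) (fun i => nth 0 Y i)).
- move=> i; have [|c] := XY (nth 0 X i); first exact: mem_nth.
  by rewrite sumE; exists (fun j => c (nth 0 Y j)).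
- move=> i; have [|c] := YX (nth 0 Y i); first exact: mem_nth.
  by rewrite sumE; exists (fun j => c (nth 0 X j)).
move=> c cU i; pose e x := oapp c 0 (insub (index x X)).
(* the coefficients indexed by positions become a function of the elements *)
have eE (j : 'I_#|` X|) : e (nth 0 X j) = c j.
  by rewrite /e index_uniq ?fset_uniq // insubT //= => jX; congr c; apply: val_inj.
rewrite -eE; apply: X_free; last exact: mem_nth.
by rewrite sumE; under eq_bigr do rewrite eE.
Qed.

End CountingModulo.

(** * Minimal generators of a filtration *)

Section MinimalGenerators.
Variables (K : fieldType) (A : algType K) (FA : algFiltration A).
Variables (M : lmodType A) (F : modFiltration FA M).
Implicit Types (W X Y : {fset M}) (xi v : M).

Let sz q xi := shifted_fil_zmod FA q (dfil F xi).

Definition minimal_filtered_generators W :=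
  filtered_generators F W /\
  forall W', W' `<` W -> ~ filtered_generators F W'.

Definition degree_part W q := [fset xi in W | dfil F xi == q].
Definition lower_part W q := [fset xi in W | (dfil F xi < q)%N].

Lemma in_degree_part W q xi :
  (xi \in degree_part W q) = (xi \in W) && (dfil F xi == q).
Proof. by rewrite !inE. Qed.

Lemma in_lower_part W q xi :
  (xi \in lower_part W q) = (xi \in W) && (dfil F xi < q)%N.
Proof. by rewrite !inE. Qed.

Hypothesis FA0_scalar : forall x, x \in FA 0%N -> exists k : K, x = k%:A.

Lemma scalar_fil0 (k : K) : k%:A \in FA 0%N.
Proof. by apply: algfilZ; apply: algfil1. Qed.

Lemma fil_span_scalar W q (k : K) v :
  fil_span F W q v -> fil_span F W q (k%:A *: v).
Proof. exact: (fil_spanZ (scalar_fil0 k)). Qed.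

Lemma fil_span_combination W X q (c : M -> K) :
  {subset X <= W} -> {in X, forall xi, dfil F xi = q} ->
  fil_span F W q (\sum_(xi <- X) (c xi)%:A *: xi).
Proof.
move=> XW Xq; apply: (coef_span_sum (@sz _)) => xi xiX _.
apply: (coef_span_gen (@sz _) id); first exact: XW.
by rewrite /shifted_fil Xq // leqnn subnn scalar_fil0.
Qed.

(** In a combination of degree q the coefficient of an element of degree q lies in
    F_0 A = K. *)
Lemma degree_part_spans W q v : fil_span F W q v ->
  exists c : M -> K, fil_span F (lower_part W q) q
                       (v - \sum_(xi <- degree_part W q) (c xi)%:A *: xi).
Proof.
move=> [b bW ->].
have /choice[c cE] : forall xi, exists k : K,
    xi \in degree_part W q -> b xi = k%:A.
  move=> xi; have [|xiN] := boolP (xi \in degree_part W q); last by exists 0.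
  rewrite in_degree_part => /andP[xiW /eqP dxi].
  have := bW _ xiW; rewrite /shifted_fil dxi leqnn subnn => /FA0_scalar[k ->].
  by exists k.
exists c; rewrite (bigID (fun xi => dfil F xi == q)) /= big_fset_condE.
rewrite addrAC -sumrB big_seq big1 ?add0r => [|xi xiW]; last first.
  by rewrite cE // subrr.
apply: (coef_span_sum (@sz _)) => xi xiW dxi.
have := bW _ xiW; rewrite /shifted_fil; case: ltngtP dxi => // dq _ bxi.
  apply: (coef_span_gen (@sz _) id); first by rewrite in_lower_part xiW.
  by rewrite /shifted_fil ltnW.
by move: bxi; rewrite inE => /eqP->; rewrite scale0r; apply: (coef_span0 (@sz _)).
Qed.

(** A relation in which the coefficient of x0 is nonzero can be divided by it,
    since that coefficient is a scalar.  This expresses x0 by the other elements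
    with no loss of degree, so that x0 could be removed from W. *)
Lemma degree_part_free W q (c : M -> K) : minimal_filtered_generators W ->
  fil_span F (lower_part W q) q (\sum_(xi <- degree_part W q) (c xi)%:A *: xi) ->
  {in degree_part W q, forall xi, c xi = 0}.
Proof.
move=> [genW minW] cspan x0 x0q; apply/eqP/negPn/negP => cx0.
have := x0q; rewrite in_degree_part => /andP[x0W /eqP dx0].
apply: (minW (W `\ x0)); first exact: fproperD1.
suff x0span : fil_span F (W `\ x0) q x0.
  move=> p v /genW; apply: fil_span_trans => xi xiW.
  have [->|xi0] := eqVneq xi x0; first by rewrite dx0.
  by apply: fil_span_self; rewrite !inE xi0.
have {}cspan : fil_span F (W `\ x0) q
                 (\sum_(xi <- degree_part W q) (c xi)%:A *: xi).
  apply: fil_span_restrict cspan => xi; rewrite in_lower_part !inE.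
  by case/andP=> -> dxi _; rewrite andbT; apply: contraTneq dxi => ->; rewrite dx0 ltnn.
have rest : fil_span F (W `\ x0) q
              (\sum_(xi <- degree_part W q `\ x0) (c xi)%:A *: xi).
  apply: fil_span_combination => xi.
    by rewrite in_fsetD1 in_degree_part in_fsetD1 => /and3P[-> ->].
  by rewrite in_fsetD1 in_degree_part => /and3P[_ _ /eqP].
have := fil_span_scalar (c x0)^-1 (coef_spanB (@sz _) cspan rest).
rewrite (big_fsetD1 x0) //= addrK scalerA -scalerAl mul1r scalerA mulVf //.
by rewrite !scale1r.
Qed.

(** Elements of degree less than q are combinations of generators of degree less
    than q: the lower part is the same for all sets of filtered generators. *)
Lemma lower_part_span X Y q v : filtered_generators F Y ->
  {in X, forall xi, xi \in F (dfil F xi)} ->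
  fil_span F (lower_part X q) q v -> fil_span F (lower_part Y q) q v.
Proof.
move=> genY XF; apply: fil_span_trans => xi.
rewrite in_lower_part => /andP[xiX dxi].
apply: fil_span_restrict (genY _ _ (XF _ xiX)) => eta etaY deta.
by rewrite in_lower_part etaY (leq_ltn_trans deta).
Qed.

Lemma degree_part_card_le X Y q :
  {in X, forall xi, xi \in F (dfil F xi)} ->
  {in Y, forall xi, xi \in F (dfil F xi)} ->
  minimal_filtered_generators X -> minimal_filtered_generators Y ->
  (#|` degree_part X q| <= #|` degree_part Y q|)%N.
Proof.
move=> XF YF minX minY; have [[genX _] [genY _]] := (minX, minY).
apply: (free_le_spanning_mod_fset (K := K) (U := fil_span F (lower_part X q) q)).
- exact: (coef_span0 (@sz _)).
- by move=> u v; apply: (coef_spanD (@sz _)).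
- by move=> k u; apply: fil_span_scalar.
- move=> xi; rewrite in_degree_part => /andP[xiX /eqP dxi].
  have [|c cspan] := @degree_part_spans Y q xi; first by rewrite -dxi; apply/genY/XF.
  by exists c; apply: lower_part_span cspan.
- move=> xi; rewrite in_degree_part => /andP[xiY /eqP dxi].
  by apply: degree_part_spans; rewrite -dxi; apply/genX/YF.
- by move=> c; apply: degree_part_free.
Qed.

(** The two lists of degrees are permutations of each other. *)
Lemma card_degree_parts X Y :
  (forall q, #|` degree_part X q| = #|` degree_part Y q|) -> #|` X| = #|` Y|.
Proof.
have countE W q : #|` degree_part W q| = count_mem q (map (dfil F) W).
  by rewrite -(sum1_size (degree_part W q)) -big_fset_condE sum1_count count_map.
move=> XY; rewrite -(size_map (dfil F) X) -(size_map (dfil F) Y).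
by apply/perm_size/allP => q _ /=; rewrite -!countE XY.
Qed.

End MinimalGenerators.

(** * Standard bases are the generators of the induced filtration *)

Section InducedFiltration.
Variables (K : fieldType) (A : algType K) (FA : algFiltration A).
Variables (M : lmodType A) (FM : modFiltration FA M).
Hypothesis FM_exhaustive : forall v, exists q, v \in FM q.
Variables (N : {pred M}) (N_sub : submod_closed N).
Let FN := induced_filtration FM N_sub.
Implicit Types (W : {fset M}) (xi v : M).

Lemma dfil_induced W : {subset W <= N} -> 0 \notin W ->
  {in W, forall xi, xi \in FN (dfil FN xi) /\ xi \notin zprev FN (dfil FN xi)}.
Proof.
move=> WN W0 xi xiW; have [q xiq] := FM_exhaustive xi.
apply: (dfilP (q := q)); first by rewrite inE WN.
by apply: contraNneq W0 => <-.
Qed.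

(** The single term 1 * xi, in which 1 has degree 0, is allowed in degree
    [n xi]. *)
Lemma standard_basis_mem (n : M -> nat) W :
  (forall q v, v \in FN q <->
    exists2 b : M -> nat -> A,
      forall xi p, xi \in W -> (p + n xi <= q)%N -> b xi p \in FA p
    & v = \sum_(xi <- W) (\sum_(p < q.+1 | (p + n xi <= q)%N) b xi p) *: xi) ->
  {in W, forall xi, xi \in FN (n xi)}.
Proof.
move=> nP xi xiW; apply/nP.
exists (fun eta p => if (eta == xi) && (p == 0)%N then 1 else 0).
  by move=> eta p _ _; case: ifP => [/andP[_ /eqP->]|_]; rewrite ?algfil1 ?rpred0.
rewrite (big_fsetD1 xi) //= [X in _ + X]big_seq [X in _ + X]big1 => [|eta].
  rewrite addr0 (bigD1 ord0) //= !eqxx big1 ?addr0 ?scale1r // => p /andP[_].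
  by rewrite -val_eqE /= => /negPf->.
by rewrite !inE => /andP[/negPf-> _]; rewrite big1 ?scale0r.
Qed.

(** From left to right the inner sum is a single coefficient, of degree at most
    q - n xi <= q - d(xi).  Conversely, one coefficient is written as an inner sum
    whose only nonzero term is at p = q - d(xi). *)
Lemma standard_basisP W : {subset W <= N} -> 0 \notin W ->
  standard_basis FM N_sub W <-> filtered_generators FN W.
Proof.
move=> WN W0; have dW := dfil_induced WN W0.
have W_neq0 : {in W, forall xi, xi != 0}.
  by move=> xi xiW; apply: contraNneq W0 => <-.
split=> [[_ _ [n nP]] q v /nP[b bF ->]|genW].
  exists (fun xi => \sum_(p < q.+1 | (p + n xi <= q)%N) b xi p) => // xi xiW.
  have dn : (dfil FN xi <= n xi)%N.
    by apply: dfil_le (W_neq0 _ xiW); apply: (standard_basis_mem nP).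
  rewrite /shifted_fil; case: leqP => dq.
    apply: rpred_sum => p pq; apply: zfil_le (bF _ _ xiW pq).
    by rewrite leq_subRL // addnC (leq_trans _ pq) // leq_add2l.
  rewrite inE big_pred0 // => p; apply/negbTE; rewrite -ltnNge.
  by rewrite (leq_trans dq) // (leq_trans dn) // leq_addl.
split=> //; exists (dfil FN) => q v; split=> [/genW[c cF ->]|[b bF ->]].
  exists (fun xi p => if (p + dfil FN xi == q)%N then c xi else 0).
    move=> xi p xiW _; case: eqP => [pq|_]; last exact: rpred0.
    by have := cF _ xiW; rewrite /shifted_fil -pq leq_addl addnK.
  rewrite big_seq [RHS]big_seq; apply: eq_bigr => xi xiW; congr (_ *: _).
  have := cF _ xiW; rewrite /shifted_fil; case: leqP => [dq _|qd].
    have pq : (q - dfil FN xi < q.+1)%N by rewrite ltnS leq_subr.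
    rewrite (bigD1 (Ordinal pq)) /= ?subnK // eqxx big1 ?addr0 // => p /andP[_].
    apply: contraNeq; have [pE _|] := eqVneq (p + dfil FN xi)%N q; last by rewrite eqxx.
    apply/eqP/val_inj; move/(congr1 (subn^~ (dfil FN xi))): pE.
    by rewrite addnK.
  rewrite inE => /eqP->; rewrite big1 // => p _; exact: if_same.
rewrite big_seq; apply: rpred_sum => xi xiW.
rewrite scaler_suml; apply: rpred_sum => p pq.
have [xiF _] := dW _ xiW.
exact: zfil_le pq _ (modfilM (bF _ _ xiW pq) xiF).
Qed.

Lemma minimal_standard_basisP W : {subset W <= N} -> 0 \notin W ->
  minimal_standard_basis FM N_sub W <-> minimal_filtered_generators FN W.
Proof.
move=> WN W0.
have sub W' : W' `<=` W -> {subset W' <= N} /\ 0 \notin W'.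
  by move=> /fsubsetP W'W; split=> [xi /W'W/WN //|]; apply: contra W0 => /W'W.
split=> -[/(standard_basisP WN W0) gen min]; split=> // W' W'W gen'.
all: have [W'N W'0] := sub _ (fproper_sub W'W).
all: by apply: (min _ W'W); apply/standard_basisP.
Qed.

End InducedFiltration.

(** * Minimality of symbols and of Rees lifts *)

(** For an injective map, the subsets of the image are the images of the
    subsets. *)
Lemma minimal_imfset (I J : choiceType) (f : I -> J) (W : {fset I})
    (Q : {fset J} -> Prop) : {in W &, injective f} ->
  (forall S : {fset J}, S `<` [fset f i | i in W] -> ~ Q S) <->
  (forall W' : {fset I}, W' `<` W -> ~ Q [fset f i | i in W']).
Proof.
move=> f_inj; split=> [min W'|min S].
  rewrite fproperEcard => /andP[/fsubsetP W'W cardW'].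
  apply: min; rewrite fproperEcard subset_imfset //= !card_in_imfset //.
  by move=> i j /W'W iW /W'W jW; apply: f_inj.
rewrite fproperEneq => /andP[S_neq /fsubsetP SW].
have SE : S = [fset f i | i in [fset i in W | f i \in S]].
  apply/fsetP => x; apply/idP/imfsetP => [xS|[i /= + ->]]; last first.
    by rewrite !inE => /andP[].
  have /imfsetP[i /= iW xE] := SW _ xS.
  by exists i => //; rewrite !inE iW -xE.
rewrite SE; apply: min; rewrite fproperEneq; apply/andP; split.
  by apply: contraNneq S_neq => WE; rewrite SE WE.
by apply/fsubsetP => i; rewrite !inE => /andP[].
Qed.

Section Symbols.
Variables (K : fieldType) (A : algType K) (FA : algFiltration A).
Variables (M : lmodType A) (F : modFiltration FA M) (W : {fset M}).
Hypothesis W_dfil :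
  {in W, forall xi, xi \in F (dfil F xi) /\ xi \notin zprev F (dfil F xi)}.

Let WF : {in W, forall xi, xi \in F (dfil F xi)}.
Proof. by move=> xi /W_dfil[]. Qed.

Let W_sub W' : W' `<` W -> {subset W' <= W}.
Proof. by move=> /fproper_sub/fsubsetP. Qed.

(** Lifts of different degrees differ because a nonzero element has a nonzero
    lift; this is where xi <> 0 is used, in the form xi is not in F_{d(xi)-1}. *)
Lemma tau_inj : {in W &, injective (tau F)}.
Proof.
move=> xi eta xiW etaW /(congr1 (fun f : dsum _ => f (dfil F xi))) /=.
rewrite dfwith_in; have [[xiF xiN] [etaF _]] := (W_dfil xiW, W_dfil etaW).
have [dE|dN] := eqVneq (dfil F eta) (dfil F xi).
  rewrite -dE in xiF *; rewrite dfwith_in => /(congr1 val).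
  by rewrite !in_part_val.
rewrite dfwith_out // => /(congr1 val); rewrite in_part_val //= => xi0.
case/negP: xiN; rewrite {1}xi0; case: (dfil F xi) => [|q]; first exact: eqxx.
exact: rpred0.
Qed.

Lemma minimal_generators_tau :
  minimal_filtered_generators F W <->
  minimal_homogeneous_generating_set [fset tau F xi | xi in W].
Proof.
have min_tau := minimal_imfset (@generates _ _) tau_inj.
split=> [[gen min]|[_ gen min]]; split.
- by move=> x /imfsetP[xi /= _ ->]; eexists; eexists.
- exact/(generates_tau WF).
- apply/min_tau => W' W'W /generates_tau gen'; apply: (min _ W'W); apply: gen'.
  by move=> xi /(W_sub W'W)/WF.
- exact/(generates_tau WF).
- move/min_tau: min => min W' W'W gen'; apply: (min _ W'W).
  by apply/generates_tau => // xi /(W_sub W'W)/WF.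
Qed.

(** If xi and eta have the same symbol, W without eta has the same symbols as W,
    hence still generates the filtration. *)
Lemma sigma_inj :
  minimal_filtered_generators F W -> {in W &, injective (sigma F)}.
Proof.
move=> [gen min] xi eta xiW etaW s_eq; apply/eqP/negPn/negP => xi_neq.
apply: (min (W `\ eta)); first exact: fproperD1.
apply/generates_sigma => [zeta|]; first by rewrite !inE => /andP[_ /WF].
suff <- : [fset sigma F zeta | zeta in W] = [fset sigma F zeta | zeta in W `\ eta].
  exact/(generates_sigma WF).
apply/fsetP => x; apply/imfsetP/imfsetP => -[zeta /= zetaW ->]; last first.
  by exists zeta => //; move: zetaW; rewrite !inE => /andP[].
have [->|zeta_neq] := eqVneq zeta eta; last by exists zeta; rewrite ?inE ?zeta_neq.
by exists xi; rewrite ?inE ?xi_neq.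
Qed.

Lemma minimal_generators_sigma :
  minimal_filtered_generators F W <->
  {in W &, injective (sigma F)} /\
  minimal_homogeneous_generating_set [fset sigma F xi | xi in W].
Proof.
split=> [minW|[s_inj [_ gen min]]].
  have s_inj := sigma_inj minW; split=> //; have [gen min] := minW; split.
  - by move=> x /imfsetP[xi /= _ ->]; eexists; eexists.
  - exact/(generates_sigma WF).
  apply/(minimal_imfset _ s_inj) => W' W'W /generates_sigma gen'.
  by apply: (min _ W'W); apply: gen' => xi /(W_sub W'W)/WF.
split; first exact/(generates_sigma WF).
move/(minimal_imfset _ s_inj): min => min W' W'W gen'; apply: (min _ W'W).
by apply/generates_sigma => // xi /(W_sub W'W)/WF.
Qed.

End Symbols.

(** * The algebra in degree zero, and the theorem *)

(** Since the weights are positive, the only monomial of degree 0 is 1. *)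
Lemma wfil0_scalar (K : fieldType) (A : algType K) (n : nat) (a : 'I_n -> A)
    (d : 'I_n -> nat) (x : A) :
  (forall i, (0 < d i)%N) -> x \in wfil a d 0 -> exists k : K, x = k%:A.
Proof.
move=> d_gt0 /asboolP[c c0 ->]; exists (\sum_(alpha <- finsupp c) c alpha).
rewrite scaler_suml /lincomb big_seq [RHS]big_seq.
apply: eq_bigr => alpha alphac; congr (_ *: _); apply: big1 => i _.
have := c0 _ alphac; rewrite leqn0 sum_nat_eq0 => /forallP/(_ i).
by rewrite muln_eq0 eqn0Ngt d_gt0 => /eqP->; rewrite expr0.
Qed.

Theorem proposition4p7 (K : fieldType) (A : algType K) (n : nat) (a : 'I_n -> A)
    (le : rel (expo n)) (A_solvable : solvable_polynomial_algebra a le)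
    (d : 'I_n -> nat) (d_gt0 : forall i, (0 < d i)%N)
    (A_filtered : weighted_filtered a d)
    (M : lmodType A) (FM : filteredModule (weighted_filtration A_filtered) M)
    (N : {pred M}) (N_sub : submod_closed N) :
  let FN := induced_filtration FM N_sub in
  (forall W : {fset M}, {subset W <= N} -> 0 \notin W ->
     (minimal_standard_basis FM N_sub W <->
        {in W &, injective (sigma FN)} /\
        minimal_homogeneous_generating_set [fset sigma FN xi | xi in W]) /\
     (minimal_standard_basis FM N_sub W <->
        minimal_homogeneous_generating_set [fset tau FN xi | xi in W])) /\
  (forall W1 W2 : {fset M},
     minimal_standard_basis FM N_sub W1 -> minimal_standard_basis FM N_sub W2 ->
     #|` W1| = #|` W2| /\
     forall q, #|` [fset xi in W1 | dfil FN xi == q]| =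
               #|` [fset xi in W2 | dfil FN xi == q]|).
Proof.
move=> FN; have FM_ex := fmfil_exhaustive FM; split=> [W WN W0|W1 W2 min1 min2].
  have W_dfil := dfil_induced FM_ex N_sub WN W0.
  have minP := minimal_standard_basisP FM_ex N_sub WN W0.
  split; apply: (iff_trans minP).
    exact: minimal_generators_sigma.
  exact: minimal_generators_tau.
have gens W : minimal_standard_basis FM N_sub W ->
    {in W, forall xi, xi \in FN (dfil FN xi)} /\ minimal_filtered_generators FN W.
  move=> minW; have [[WN W0 _] _] := minW; split; last first.
    exact/(minimal_standard_basisP FM_ex N_sub WN W0).
  by move=> xi /(dfil_induced FM_ex N_sub WN W0)[].
have [[F1 gens1] [F2 gens2]] := (gens _ min1, gens _ min2).
have FA0 x : x \in weighted_filtration A_filtered 0%N -> exists k : K, x = k%:A.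
  exact: wfil0_scalar.
have cardE q : #|` degree_part FN W1 q| = #|` degree_part FN W2 q|.
  by apply/eqP; rewrite eqn_leq !degree_part_card_le.
by split; first exact: card_degree_parts cardE.
Qed.
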